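(* (Back-and-forth versus cyclic versus ordered dealing in bridge.) Consider the following three dealing methods for bridge, viewed as decks of $n=52$ cards with values $\mathtt N,\mathtt E,\mathtt S,\mathtt W$, each occurring 13 times (exponents denote repetition of a word): $$D'_{\mathrm{ord}}=\mathtt N^{13}\mathtt E^{13}\mathtt S^{13}\mathtt W^{13},\qquad D'_{\mathrm{cyc}}=(\mathtt{NESW})^{13},\qquad D'_{\mathrm{bf}}=(\mathtt{NESWWSEN})^{6}\,\mathtt{NESW}.$$ Then $$\overline{\kappa}_1(D'_{\mathrm{ord}})=\frac{93574839271687495932003418573}{3352796110343049552452340000},$$ $$\overline{\kappa}_1(D'_{\mathrm{cyc}})=\frac1{13}\,\overline{\kappa}_1(D'_{\mathrm{ord}})=\frac{7198064559360576610154109121}{3352796110343049552452340000},$$ $$\overline{\kappa}_1(D'_{\mathrm{bf}})=\frac1{13}\,\overline{\kappa}_1(D'_{\mathrm{cyc}})=\frac{7198064559360576610154109121}{43586349434459644181880420000}.$$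
   Context: A deck of $n$ cards is a function $D$ from $\{1,\dots,n\}$ to a set of values, written as the word $D(1)D(2)\cdots D(n)$. $\mathcal O(D')$ is the set of all reorderings of $D'$ (decks with the same multiset of values), $N=\#\mathcal O(D')$, and $n_v$ is the number of cards of value $v$ in $D'$. A $u$-$v$ digraph in $D$ is an index $i$ with $D(i)=u$, $D(i+1)=v$. A $u$-$v$ pair in $D$ is a pair $(i,j)$ with $i<j$, $D(i)=u$, $D(j)=v$. Define $W(D,u,v)=\#\{u\text{-}v\text{ digraphs in }D\}-\#\{v\text{-}u\text{ digraphs in }D\}$ and $Z(D,u,v)=\#\{u\text{-}v\text{ pairs in }D\}-\#\{v\text{-}u\text{ pairs in }D\}$. For $D\in\mathcal O(D')$, with any fixed total order on the values, $$c_1(D,D')=\frac{n}{2N}\sum_{u<v}\frac{W(D,u,v)Z(D',u,v)}{n_un_v},\qquad \overline{\kappa}_1(D')=\frac12\sum_{D\in\mathcal O(D')}|c_1(D,D')|.$$ ($\overline\kappa_1(D')$ is the coefficient of $a^{-1}$ in the variation distance from uniform of the partition into hands obtained by an $a$-shuffle followed by dealing according to $D'$.) *)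

(* Defs.v *)
From HB Require Import structures.
From mathcomp Require Import all_boot all_order all_algebra.

Set Implicit Arguments.
Unset Strict Implicit.
Unset Printing Implicit Defensive.

Import Order.TTheory GRing.Theory Num.Theory.

Local Open Scope ring_scope.

Section Decks.
Variables (n : nat) (V : finType).

(* A deck of n cards with values in V is a tuple D : n.-tuple V. Positions are
   the elements of 'I_n, i.e. they are numbered from 0 instead of from 1. *)
Implicit Types (D : n.-tuple V) (u v : V).

Definition reorderings D : {set n.-tuple V} :=
  [set D1 : n.-tuple V | perm_eq D1 D].

Definition ndigraphs D u v : nat :=
  #|[set i : 'I_n | [exists j : 'I_n,
       [&& (j : nat) == i.+1, tnth D i == u & tnth D j == v]]]|.

Definition npairs D u v : nat :=
  #|[set p : 'I_n * 'I_n |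
       [&& (p.1 < p.2)%N, tnth D p.1 == u & tnth D p.2 == v]]|.

Definition Wstat D u v : rat := (ndigraphs D u v)%:R - (ndigraphs D v u)%:R.

Definition Zstat D u v : rat := (npairs D u v)%:R - (npairs D v u)%:R.

(* The sum ranges over the pairs u < v for the strict part of le. A value that
   does not occur in D' contributes 0, since then Zstat D' u v = 0. *)
Definition c1 (le : rel V) D D' : rat :=
  n%:R / (2 * #|reorderings D'|%:R)
  * \sum_(u : V) \sum_(v : V | (u != v) && le u v)
      Wstat D u v * Zstat D' u v
      / ((count_mem u D')%:R * (count_mem v D')%:R).

Definition kappa1 (le : rel V) D' : rat :=
  2^-1 * \sum_(D in reorderings D') `|c1 le D D'|.

End Decks.

Inductive seat : Set := North | East | South | West.

Definition ord_of_seat (s : seat) : 'I_4 :=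
  match s with
  | North => @Ordinal 4 0 isT | East => @Ordinal 4 1 isT
  | South => @Ordinal 4 2 isT | West => @Ordinal 4 3 isT
  end.

Definition seat_of_ord (i : 'I_4) : seat :=
  match val i with 0 => North | 1 => East | 2 => South | _ => West end.

Lemma ord_of_seatK : cancel ord_of_seat seat_of_ord.
Proof. by case. Qed.

HB.instance Definition _ := Countable.copy seat (can_type ord_of_seatK).

Lemma seat_enumP : Finite.axiom [:: North; East; South; West].
Proof. by case. Qed.

HB.instance Definition _ := isFinite.Build seat seat_enumP.

Definition word_pow (k : nat) (w : seq seat) : seq seat := flatten (nseq k w).

Definition word_ord : seq seat :=
  word_pow 13 [:: North] ++ word_pow 13 [:: East]
  ++ word_pow 13 [:: South] ++ word_pow 13 [:: West].

Definition word_cyc : seq seat := word_pow 13 [:: North; East; South; West].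

Definition word_bf : seq seat :=
  word_pow 6 [:: North; East; South; West; West; South; East; North]
  ++ [:: North; East; South; West].

Definition D_ord : 52.-tuple seat := @Tuple 52 seat word_ord isT.
Definition D_cyc : 52.-tuple seat := @Tuple 52 seat word_cyc isT.
Definition D_bf : 52.-tuple seat := @Tuple 52 seat word_bf isT.

(* Main.v *)
From Stdlib Require Import NArith.
Require Import Defs.
From mathcomp Require Import all_boot all_order all_algebra.
From mathcomp Require Import zify ring.

(* For each of the three decks [Z(D',u,v)] is the same number [z] for all [u < v]
   in the order N < E < S < W, namely 169, 13 and 1. Since the sum of [W(D,u,v)]
   over [u < v] is the number of ascents of [D] minus the number of its descents,
   kappa1 is [z / 13] times the mean of |ascents - descents| over all words with
   13 letters of each kind. The order on the values is irrelevant because [W Z] is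
   symmetric in [u] and [v].
   To compute that mean, insert the letters kind by kind in increasing order.
   The numbers of ascents and descents after inserting copies of a new maximal
   letter depend only on how many gaps of each kind (ascents, descents, plateaus,
   both ends) receive a block of copies, so the sum over all 52!/13!^4 words
   becomes a short sum of products of binomial coefficients. *)

Set Implicit Arguments.
Unset Strict Implicit.
Unset Printing Implicit Defensive.

Import Order.TTheory GRing.Theory Num.Theory.

Local Open Scope nat_scope.

(** * Inserting copies of a maximal letter *)

Definition binsum n (g : nat -> nat) := \sum_(i < n.+1) 'C(n, i) * g i.

Lemma eq_binsum n g h : g =1 h -> binsum n g = binsum n h.
Proof. by move=> gh; apply: eq_bigr => i _; rewrite gh. Qed.

Lemma binsum0 g : binsum 0 g = g 0.
Proof. by rewrite /binsum big_ord1 bin0 mul1n. Qed.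

Lemma binsumD n g h : binsum n (fun i => g i + h i) = binsum n g + binsum n h.
Proof. by rewrite -big_split; apply: eq_bigr => i _; rewrite /= mulnDr. Qed.

Lemma binsumS n g : binsum n.+1 g = binsum n g + binsum n (fun i => g i.+1).
Proof.
rewrite /binsum big_ord_recl bin0 mul1n.
under eq_bigr => i _ do rewrite /= binS mulnDl.
rewrite big_split /= addnA; congr (_ + _).
by rewrite big_ord_recr /= bin_small // mul0n addn0 [RHS]big_ord_recl bin0 mul1n.
Qed.

(** Both sums extend to the common range up to [n + r]: terms beyond [n] vanish through the
    binomial, terms beyond [r] through [g]. *)
Lemma binsum_trunc n r g : (forall i, r < i -> g i = 0) ->
  binsum n g = \sum_(i < r.+1) 'C(n, i) * g i.
Proof.
move=> g0; rewrite /binsum.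
pose F i := 'C(n, i) * g i.
have E m : m <= n + r -> (forall i, m < i -> F i = 0) ->
    \sum_(i < m.+1) F i = \sum_(i < (n + r).+1) F i.
  move=> le_m F0; rewrite -(subnKC (_ : m.+1 <= (n + r).+1)) // big_split_ord /=.
  by rewrite [X in _ + X]big1 ?addn0 // => i _; rewrite F0 //; lia.
rewrite (E n) ?(E r) ?leq_addr ?leq_addl // => i lt_i; rewrite /F.
  by rewrite g0 ?muln0.
by rewrite bin_small.
Qed.

(* The number of ways to write r as an ordered sum of m positive integers. *)
Definition compositions r m := if m <= r then 'C(r.-1, r - m) else 0.

Lemma compositionsSS r m : compositions r.+1 m.+1 = 'C(r, m).
Proof.
rewrite /compositions ltnS subSS /=; case: leqP => h; first by rewrite bin_sub.
by rewrite bin_small.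
Qed.

(** The lower index [r - m], unlike the truncated [m.-1], yields the right value at [m = 0] without
    a separate clause. *)
Lemma compositionsS0 r : compositions r.+1 0 = 0.
Proof. by rewrite /compositions bin_small. Qed.

(** ['C(r, m)] counts the distributions of [r] copies over [m] gaps that must be filled and one that
    may stay empty. With [r.+1] copies the optional gap either takes a copy or takes none. *)
Lemma bin_compositions r m : 'C(r.+1, m) = 'C(r, m) + compositions r.+1 m.
Proof. by case: m => [|m]; rewrite ?compositionsS0 ?compositionsSS ?bin0 // binS. Qed.

Lemma compositions0 m : compositions 0 m = 'C(0, m).
Proof. by case: m. Qed.

Section GapSum.
Implicit Types (f g : nat -> nat -> nat -> nat).

(* The indices [i], [j], [k] count the gaps receiving a block of maximal letters:
   ascents, descents together with the end of the word, and plateaus. A block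
   turns a gap between smaller letters into an ascent followed by a descent. *)
Definition gapsum A D P f :=
  binsum A (fun i => binsum D.+1 (fun j => binsum P (fun k =>
    f (i + j + k) (j + k) (i + k)))).

Lemma eq_gapsum A D P f g : (forall m a d, f m a d = g m a d) ->
  gapsum A D P f = gapsum A D P g.
Proof. by move=> fg; do 3![apply: eq_binsum => ?]. Qed.

Lemma gapsumD A D P f g :
  gapsum A D P (fun m a d => f m a d + g m a d) = gapsum A D P f + gapsum A D P g.
Proof.
rewrite -binsumD; apply: eq_binsum => i; rewrite -binsumD; apply: eq_binsum => j.
by rewrite -binsumD; apply: eq_binsum => k.
Qed.

(** Pascal's rule for one additional gap, which stays empty or receives a block; likewise for the
    other two kinds of gap below. *)
Lemma gapsumSA A D P f :
  gapsum A.+1 D P f = gapsum A D P f + gapsum A D P (fun m a d => f m.+1 a d.+1).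
Proof. by rewrite /gapsum binsumS. Qed.

Lemma gapsumSD A D P f :
  gapsum A D.+1 P f = gapsum A D P f + gapsum A D P (fun m a d => f m.+1 a.+1 d).
Proof.
rewrite -binsumD; apply: eq_binsum => i; rewrite binsumS; congr (_ + _).
by apply: eq_binsum => j; apply: eq_binsum => k; rewrite addnS !addSn.
Qed.

Lemma gapsumSP A D P f :
  gapsum A D P.+1 f = gapsum A D P f + gapsum A D P (fun m a d => f m.+1 a.+1 d.+1).
Proof.
rewrite -binsumD; apply: eq_binsum => i; rewrite -binsumD; apply: eq_binsum => j.
by rewrite binsumS; congr (_ + _); apply: eq_binsum => k; rewrite !addnS.
Qed.

Lemma gapsum_bin0 A D P (g : nat -> nat -> nat) :
  gapsum A D P (fun m a d => 'C(0, m) * g a d) = g 0 0.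
Proof.
have b0 n h : (forall i, h i.+1 = 0) -> binsum n h = h 0.
  move=> h0; rewrite (@binsum_trunc n 0) ?big_ord1 ?bin0 ?mul1n //.
  by case=> // i _; apply: h0.
rewrite /gapsum b0 => [|i]; last first.
  by rewrite /binsum big1 // => j _; rewrite big1 ?muln0 // => k _; rewrite muln0.
rewrite b0 => [|j]; last by rewrite /binsum big1 // => k _; rewrite muln0.
by rewrite b0 ?bin0 ?mul1n // => k; rewrite mul0n.
Qed.

End GapSum.

(* The start of the word behaves like an ascent and its end like a descent, hence
   the successors. *)
Definition step L r (f : nat -> nat -> nat) a d :=
  binsum a.+1 (fun i => binsum d.+1 (fun j => binsum (L.-1 - a - d)
    (fun k => compositions r (i + j + k) * f (a + j + k) (d + i + k)))).

(** * Words, their ascents and descents, and the insertion of a letter *)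

Section Words.
Variables (T : eqType) (lt : rel T).
Implicit Types (e : rel T) (s u w : seq T) (x y : T).

Fixpoint steps_from e x s : nat :=
  if s is y :: s' then e x y + steps_from e y s' else 0.

Definition steps e s := if s is x :: s' then steps_from e x s' else 0.

Definition asc := steps lt.
Definition des := steps (fun x y => lt y x).

Section Insertions.
Variable M : T.

(** The resulting word starts with a copy of [M] or with the first letter of [w]. The nested
    fixpoint is needed because each case decreases a different argument. *)
Fixpoint insertions r : seq T -> seq (seq T) :=
  if r is r'.+1 then
    fix ins w := [seq M :: u | u <- insertions r' w]
                 ++ (if w is x :: w' then [seq x :: u | u <- ins w'] else [::])
  else fun w => [:: w].

Lemma insertionsS r w : insertions r.+1 w =
  [seq M :: u | u <- insertions r w]
  ++ (if w is x :: w' then [seq x :: u | u <- insertions r.+1 w'] else [::]).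
Proof. by case: w. Qed.

(** Erasing [M] undoes the insertion. Since [M] is not in [w], the first letter of [u] tells which
    branch produced it. *)
Lemma mem_insertions r w u : M \notin w ->
  (u \in insertions r w) = (count_mem M u == r) && (filter (predC1 M) u == w).
Proof.
have mem_cons (x y : T) u' (s : seq (seq T)) :
    (y :: u' \in [seq x :: u0 | u0 <- s]) = (x == y) && (u' \in s).
  apply/mapP/idP => [[u0 u0s [-> ->]]|/andP[/eqP-> u's]]; [by rewrite eqxx|by exists u'].
have mem_nil (x : T) (s : seq (seq T)) : ([::] \in [seq x :: u0 | u0 <- s]) = false.
  by apply/negP => /mapP[].
elim: r w u => [|r IHr] w u Mw.
  rewrite inE; apply/eqP/andP => [->|[/eqP c0 /eqP <-]].
    split; first by rewrite -leqn0 leqNgt -has_count has_pred1.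
    apply/eqP/all_filterP/allP => x xw /=; by apply: contraNneq Mw => <-.
  apply/esym/all_filterP/allP => x xu /=; apply/negP => /eqP xM.
  by move: c0; apply/eqP; rewrite -lt0n -has_count has_pred1 -xM.
elim: w u Mw => [|x w IHw] u Mw; rewrite insertionsS ?cats0 ?mem_cat.
  case: u => [|y u]; first by rewrite mem_nil.
  rewrite mem_cons IHr //= [M == y]eq_sym.
  by have [_|_] /= := eqVneq y M; rewrite ?add1n ?andbF.
have [xM Mw'] : x != M /\ M \notin w by move: Mw; rewrite inE negb_or eq_sym => /andP.
case: u => [|y u]; first by rewrite !mem_nil.
rewrite !mem_cons IHr // IHw //= [M == y]eq_sym.
have [->|yM] /= := eqVneq y M; first by rewrite (negbTE xM) orbF.
by rewrite add0n eqseq_cons [y == x]eq_sym andbCA.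
Qed.

Lemma insertions_uniq r w : M \notin w -> uniq (insertions r w).
Proof.
have cons_inj (y : T) : injective (cons y) by move=> a b [].
elim: r w => [//|r IHr] w; elim: w => [|x w IHw] Mw; rewrite insertionsS.
  by rewrite cats0 map_inj_uniq ?IHr.
have [xM Mw'] : x != M /\ M \notin w by move: Mw; rewrite inE negb_or eq_sym => /andP.
rewrite cat_uniq !map_inj_uniq // IHr // IHw // andbT /=.
apply/hasPn => _ /mapP[u _ ->]; apply/negP => /mapP[u' _ [xM' _]].
by rewrite xM' eqxx in xM.
Qed.

Lemma size_insertions r w : size (insertions r w) = 'C(size w + r, r).
Proof.
elim: r w => [|r IHr] w; first by rewrite addn0 bin0.
elim: w => [|x w IHw]; rewrite insertionsS.
  by rewrite cats0 size_map IHr !add0n !binn.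
by rewrite size_cat !size_map IHw IHr /= !addSn addnS binS addnC.
Qed.

(** Erasing [M] partitions the words on the left into fibres, and the fibre over [w] is
    [insertions r w] up to order. *)
Lemma big_permutations_insertions r s (F : seq T -> nat) : M \notin s ->
  \sum_(u <- permutations (s ++ nseq r M)) F u =
  \sum_(w <- permutations s) \sum_(u <- insertions r w) F u.
Proof.
move=> Ms; have Mw w : w \in permutations s -> M \notin w.
  by rewrite mem_permutations => /perm_mem ->.
have E u : perm_eq u (s ++ nseq r M) =
    (count_mem M u == r) && perm_eq (filter (predC1 M) u) s.
  have sE : [seq x <- s | predC1 M x] = s.
    by apply/all_filterP/allP => x xs /=; apply: contraNneq Ms => <-.
  have nE : [seq x <- nseq r M | predC1 M x] = [::].
    by apply/eqP; rewrite -size_eq0 size_filter count_nseq /= eqxx.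
  apply/idP/andP => [h|[/eqP cr h]].
    split; last by have := perm_filter (predC1 M) h; rewrite filter_cat sE nE cats0.
    rewrite (permP h) count_cat count_nseq /= eqxx mul1n.
    rewrite [count_mem M s](_ : _ = 0) //.
    by apply/eqP; rewrite -leqn0 leqNgt -has_count has_pred1.
  have uE : perm_eq u (filter (predC1 M) u ++ filter (pred1 M) u).
    by rewrite perm_sym perm_catC perm_filterC.
  apply: perm_trans uE _; apply: perm_cat => //.
  have /all_pred1P-> : all (pred1 M) (filter (pred1 M) u) by apply: filter_all.
  by rewrite size_filter cr.
under [RHS]eq_big_seq => w pw.
  rewrite (perm_big [seq u <- permutations (s ++ nseq r M) | filter (predC1 M) u == w]).
    rewrite big_filter big_mkcond /=; over.
  apply: uniq_perm; rewrite ?insertions_uniq ?filter_uniq ?permutations_uniq ?Mw //.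
  move=> u; rewrite mem_insertions ?Mw // mem_filter mem_permutations E.
  have [->|_] := eqVneq (filter (predC1 M) u) w; last by rewrite andbF.
  by rewrite -mem_permutations pw andbT.
rewrite exchange_big /=; apply: eq_big_seq => u.
rewrite mem_permutations E => /andP[_]; rewrite -mem_permutations => pu.
rewrite (bigD1_seq (filter (predC1 M) u)) ?permutations_uniq //= eqxx.
by rewrite big1 ?addn0 // => w; rewrite eq_sym => /negbTE->.
Qed.


Hypothesis lt_asym : forall x y, lt x y -> lt y x = false.

Let gt : rel T := fun x y => lt y x.
Let tie : rel T := fun x y => ~~ lt x y && ~~ lt y x.

Lemma steps_from_size x s :
  steps_from lt x s + steps_from gt x s + steps_from tie x s = size s.
Proof.
elim: s x => //= y s IHs x; rewrite -(IHs y) /gt /tie.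
case: (boolP (lt x y)) => [/lt_asym->|_] /=; first lia.
case: (lt y x) => /=; lia.
Qed.

(** The two claims differ in the letter preceding the rest of the word: a smaller letter [x], or [M]
    itself. In the second case a block is already open and may take any number of further copies,
    hence ['C(r, m)]; closing it before [x] costs one descent. The proof is a joint induction on
    [r]. *)
Lemma big_insertions_steps_from r :
  (forall x w (f : nat -> nat -> nat), all (lt^~ M) (x :: w) ->
    \sum_(u <- insertions r w) f (steps_from lt x u) (steps_from gt x u) =
    gapsum (steps_from lt x w) (steps_from gt x w) (steps_from tie x w)
      (fun m a d => compositions r m
         * f (steps_from lt x w + a) (steps_from gt x w + d))) /\
  (forall x w (f : nat -> nat -> nat), all (lt^~ M) (x :: w) ->
    \sum_(u <- insertions r (x :: w)) f (steps_from lt M u) (steps_from gt M u) =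
    gapsum (steps_from lt x w) (steps_from gt x w) (steps_from tie x w)
      (fun m a d => 'C(r, m)
         * f (steps_from lt x w + a) ((steps_from gt x w).+1 + d))).
Proof.
have irr : lt M M = false by apply/negP => h; have := lt_asym h; rewrite h.
(* Copies appended to an [M] at the end of the word only create plateaus. *)
have nil_sum r' (f : nat -> nat -> nat) :
    \sum_(u <- insertions r' [::]) f (steps_from lt M u) (steps_from gt M u) = f 0 0.
  elim: r' => [|r' IHr] /=; first by rewrite big_seq1.
  rewrite cats0 big_map -[RHS]IHr; apply: eq_bigr => u _ /=.
  by rewrite /gt irr.
elim: r => [|r [IH1 IH2]].
  split=> x w f /andP[xM wM]; rewrite big_seq1.
    under eq_gapsum => m a d do rewrite compositions0.
    by rewrite gapsum_bin0 !addn0.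
  by rewrite gapsum_bin0 /= /gt xM (lt_asym xM) addn0 add0n add1n addn0.
have S1 x w (f : nat -> nat -> nat) : all (lt^~ M) (x :: w) ->
    \sum_(u <- insertions r.+1 w) f (steps_from lt x u) (steps_from gt x u) =
    gapsum (steps_from lt x w) (steps_from gt x w) (steps_from tie x w)
      (fun m a d => compositions r.+1 m
         * f (steps_from lt x w + a) (steps_from gt x w + d)).
  elim: w x f => [|y w IHw] x f xwM; rewrite insertionsS.
    have /andP[xM _] := xwM.
    rewrite cats0 big_map /= /gt xM (lt_asym xM) (nil_sum r (fun a d => f (1 + a) (0 + d))).
    rewrite /gapsum binsum0 binsumS !binsum0 compositionsS0 compositionsSS bin0.
    by rewrite add0n mul1n.
  have /andP[xM ywM] := xwM.
  (* Either a block opens between [x] and [y], which is the second claim for [r], or the gap stays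
     empty and the induction on [w] applies. *)
  rewrite big_cat !big_map /= {1 2}/gt xM (lt_asym xM).
  rewrite (IH2 _ _ (fun a d => f (1 + a) (0 + d)) ywM).
  rewrite (IHw y (fun a d => f (lt x y + a) (gt x y + d)) ywM) addnC.
  set A := steps_from lt y w; set D := steps_from gt y w; set P := steps_from tie y w.
  have [] : [\/ [/\ lt x y = true, gt x y = false & tie x y = false],
        [/\ lt x y = false, gt x y = true & tie x y = false] |
        [/\ lt x y = false, gt x y = false & tie x y = true]].
    rewrite /gt /tie; case: (boolP (lt x y)) => [/lt_asym->|_] /=; first by constructor 1.
    by case: (lt y x) => /=; [constructor 2|constructor 3].
  (* The splitting rule for the kind of the gap between [x] and [y] separates exactly these two
     cases. *)
  1,2,3: case=> -> -> ->; rewrite ?gapsumSA ?gapsumSD ?gapsumSP; congr (_ + _);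
    by apply: eq_gapsum => m a d; rewrite ?compositionsSS ?add0n ?add1n ?addSn ?addnS.
split=> // x w f xwM; rewrite insertionsS big_cat !big_map /= irr.
have /andP[xM _] := xwM; rewrite /gt irr xM (lt_asym xM) -/gt.
rewrite (IH2 _ _ (fun a d => f (0 + a) (0 + d)) xwM).
rewrite (S1 _ _ (fun a d => f (0 + a) (1 + d)) xwM) -gapsumD.
by apply: eq_gapsum => m a d; rewrite bin_compositions mulnDl !add0n add1n.
Qed.

Lemma big_insertions_steps r w (f : nat -> nat -> nat) :
    w != [::] -> all (lt^~ M) w ->
  \sum_(u <- insertions r w) f (asc u) (des u) =
  step (size w) r f (asc w) (des w).
Proof.
case: w => // x w _ xwM; have [xM _] := andP xwM.
transitivity (gapsum (steps_from lt x w).+1 (steps_from gt x w) (steps_from tie x w)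
    (fun m a d => compositions r m * f (steps_from lt x w + a) (steps_from gt x w + d))).
  (* The additional ascent is the front gap: left empty it gives the first claim, filled it gives
     the second claim with one copy fewer. *)
  rewrite gapsumSA; case: r => [|r].
    rewrite big_seq1; under [X in X + _]eq_gapsum => m a d do rewrite compositions0.
    rewrite gapsum_bin0 !addn0 [X in _ + X](_ : _ = 0) ?addn0 //.
    rewrite -[RHS](gapsum_bin0 (steps_from lt x w) (steps_from gt x w)
      (steps_from tie x w) (fun _ _ => 0)).
    by apply: eq_gapsum => m a d; rewrite muln0.
  rewrite insertionsS big_cat !big_map /= addnC; congr (_ + _).
    exact: (proj1 (big_insertions_steps_from r.+1) x w f xwM).
  rewrite [LHS](proj2 (big_insertions_steps_from r) x w f xwM).
  by apply: eq_gapsum => m a d; rewrite compositionsSS addSn addnS.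
have sz := steps_from_size x w; rewrite -/gt -/tie.
have -> : steps_from tie x w = size w - steps_from lt x w - steps_from gt x w by lia.
rewrite /step /gapsum; do 3![apply: eq_binsum => ?].
by rewrite !addnA.
Qed.

(** The right side is again a sum of a function of ascents and descents, so the lemma can be
    iterated to peel off one kind of letter at a time. *)
Lemma big_permutations_step r s (f : nat -> nat -> nat) :
    s != [::] -> all (lt^~ M) s ->
  \sum_(u <- permutations (s ++ nseq r M)) f (asc u) (des u) =
  \sum_(w <- permutations s) step (size s) r f (asc w) (des w).
Proof.
move=> s0 sM; rewrite big_permutations_insertions; last first.
  by apply/negP => /(allP sM) h; have := lt_asym h; rewrite h.
apply: eq_big_seq => w; rewrite mem_permutations => ws.
rewrite -(perm_size ws); apply: big_insertions_steps.
  by apply: contraNneq s0 => w0; move: (perm_size ws); rewrite w0 => /esym/size0nil->.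
by rewrite (perm_all _ ws).
Qed.

Lemma size_permutations_cat_nseq r s : M \notin s ->
  size (permutations (s ++ nseq r M)) = size (permutations s) * 'C(size s + r, r).
Proof.
move=> Ms; rewrite -sum1_size big_permutations_insertions //.
rewrite (eq_big_seq (fun=> 'C(size s + r, r))) ?big_const_seq ?count_predT ?iter_addn_0 1?mulnC //.
by move=> w; rewrite mem_permutations sum1_size size_insertions => /perm_size->.
Qed.

End Insertions.
End Words.

(** * Evaluation with binary numbers *)

Lemma compositions_gt r m : r < m -> compositions r m = 0.
Proof. by move=> rm; rewrite /compositions leqNgt rm. Qed.

(** At most [r] gaps can receive one of [r] copies; within these bounds the test in [compositions]
    always succeeds. *)
Lemma step_trunc L r f a d : step L r f a d =
  \sum_(i < r.+1) 'C(a.+1, i) * \sum_(j < (r - i).+1) 'C(d.+1, j) *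
    \sum_(k < (r - i - j).+1) 'C(L.-1 - a - d, k) *
      ('C(r.-1, r - (i + j + k)) * f (a + j + k) (d + i + k)).
Proof.
rewrite /step (@binsum_trunc _ r) => [|i ri]; last first.
  rewrite /binsum big1 // => j _; rewrite big1 ?muln0 // => k _.
  by rewrite compositions_gt ?muln0 //; lia.
apply: eq_bigr => i _; congr (_ * _).
rewrite (@binsum_trunc _ (r - i)) => [|j rj]; last first.
  rewrite /binsum big1 // => k _.
  by rewrite compositions_gt ?muln0 //; lia.
apply: eq_bigr => j _; congr (_ * _).
rewrite (@binsum_trunc _ (r - i - j)) => [|k rk]; last first.
  by rewrite compositions_gt ?muln0 //; lia.
apply: eq_bigr => k _; congr (_ * (_ * _)).
by rewrite /compositions ifT //; have := ltn_ord i; have := ltn_ord j; have := ltn_ord k; lia.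
Qed.

(* Blocks put into plateaus do not change the difference between ascents and
   descents: Vandermonde's identity sums them out. *)
Lemma step_diff L r (g : nat -> nat -> nat) a d :
    0 < r -> (forall x y k, g (x + k) (y + k) = g x y) ->
  step L r g a d =
  \sum_(i < r.+1) 'C(a.+1, i) * \sum_(j < (r - i).+1) 'C(d.+1, j) *
    ('C(L.-1 - a - d + r.-1, r - i - j) * g (a + j) (d + i)).
Proof.
move=> r_gt0 gD; rewrite step_trunc; apply: eq_bigr => i _; congr (_ * _).
apply: eq_bigr => j _; congr (_ * _); rewrite -binomial.Vandermonde big_distrl /=.
apply: eq_bigr => k _; rewrite gD -mulnA; congr (_ * ('C(_, _) * _)); lia.
Qed.

Lemma nat_of_add_bin (a b : N) : nat_of_bin (N.add a b) = nat_of_bin a + nat_of_bin b.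
Proof. by case: a b => [|p] [|q]; rewrite ?addn0 //; apply: nat_of_add_pos. Qed.

Lemma nat_of_mul_bin (a b : N) : nat_of_bin (N.mul a b) = nat_of_bin a * nat_of_bin b.
Proof. by case: a b => [|p] [|q]; rewrite ?muln0 //; apply: nat_of_mul_pos. Qed.

Definition sumN n (F : nat -> N) : N := foldr (fun i s => N.add (F i) s) N0 (iota 0 n).

Lemma sumNE n F : nat_of_bin (sumN n F) = \sum_(i < n) nat_of_bin (F i).
Proof.
rewrite -(big_mkord xpredT (fun i => nat_of_bin (F i))) /sumN /index_iota subn0.
by elim: (iota 0 n) => [|i s IHs]; rewrite ?big_nil // big_cons /= nat_of_add_bin IHs.
Qed.

(** The last entry is added to the default [N0], which yields the final 1 of the next row. *)
Fixpoint pascal_sums (s : seq N) :=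
  if s is x :: s' then N.add x (head N0 s') :: pascal_sums s' else [::].

Definition pascal_next s := 1%num :: pascal_sums s.

Definition pascal_row n := iter n pascal_next [:: 1%num].

(** There is no bound on [k]: beyond the row, the default [N0] agrees with the vanishing
    binomial. *)
Lemma pascal_rowE n k : nat_of_bin (nth N0 (pascal_row n) k) = 'C(n, k).
Proof.
have sumsE s i : nat_of_bin (nth N0 (pascal_sums s) i) = nth N0 s i + nth N0 s i.+1.
  elim: s i => [|x s IHs] [|i] //=; rewrite ?IHs //.
  by rewrite nat_of_add_bin; case: s {IHs}.
elim: n k => [|n IHn] [|k] //=; first by rewrite nth_nil.
by rewrite sumsE !IHn binS addnC.
Qed.

(* Outside the table the function is evaluated, so that [lookupE] has no bound. *)
Definition lookup T (x0 : T) (t : seq T) (F : nat -> T) i :=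
  if i < size t then nth x0 t i else F i.

Lemma lookupE T (x0 : T) n F i : lookup x0 (mkseq F n) F i = F i.
Proof. by rewrite /lookup size_mkseq; case: ifP => // lt_in; rewrite nth_mkseq. Qed.

(* Skips the evaluation of [b] when [a] is zero. *)
Definition mulN (a : N) (b : N) := if a is N0 then N0 else N.mul a b.

Lemma mulNE a b : nat_of_bin (mulN a b) = nat_of_bin a * nat_of_bin b.
Proof. by rewrite -nat_of_mul_bin; case: a. Qed.

Definition stepN (bin : nat -> nat -> N) L r (f : nat -> nat -> N) a d : N :=
  sumN r.+1 (fun i => mulN (bin a.+1 i) (sumN (r - i).+1 (fun j =>
    mulN (bin d.+1 j) (sumN (r - i - j).+1 (fun k =>
      mulN (bin (L.-1 - a - d) k)
        (mulN (bin r.-1 (r - (i + j + k))) (f (a + j + k) (d + i + k)))))))).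

Definition step_distN (bin : nat -> nat -> N) L r a d : N :=
  sumN r.+1 (fun i => mulN (bin a.+1 i) (sumN (r - i).+1 (fun j =>
    mulN (bin d.+1 j) (mulN (bin (L.-1 - a - d + r.-1) (r - i - j))
      (bin_of_nat (a + j - (d + i) + (d + i - (a + j)))))))).

(** The table sizes affect only the cost. Two steps from [0 0] raise each argument of [f3] to at
    most 26, and no binomial row above 50 is requested. The shortcut [step_distN] serves the last
    letter only, where the summed function depends just on a difference. *)
Definition distn_total : N :=
  let rows := mkseq pascal_row 56 in
  let bin n k := nth N0 (lookup [::] rows pascal_row n) k in
  let h a d := step_distN bin 39 13 a d in
  let tab := mkseq (fun a => mkseq (h a) 28) 28 in
  let f3 a d := lookup N0 (lookup [::] tab (fun a => mkseq (h a) 28) a) (h a) d in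
  stepN bin 13 13 (stepN bin 26 13 f3) 0 0.

Definition distn a d := (a - d) + (d - a).

Lemma distn_totalE :
  nat_of_bin distn_total = step 13 13 (step 26 13 (step 39 13 distn)) 0 0.
Proof.
rewrite /distn_total; set rows := mkseq pascal_row 56.
set bin := fun n k => nth N0 (lookup [::] rows pascal_row n) k.
have binE n k : nat_of_bin (bin n k) = 'C(n, k) by rewrite /bin lookupE pascal_rowE.
(* Only [binE] is kept, so that nothing later unfolds the table. *)
clearbody bin.
have stepE L r f g a d : (forall a d, nat_of_bin (f a d) = g a d) ->
    nat_of_bin (stepN bin L r f a d) = step L r g a d.
  move=> fg; rewrite step_trunc /stepN sumNE; apply: eq_bigr => i _.
  rewrite mulNE binE sumNE; congr (_ * _); apply: eq_bigr => j _.
  rewrite mulNE binE sumNE; congr (_ * _); apply: eq_bigr => k _.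
  by rewrite !mulNE !binE fg.
have distE L r a d : 0 < r -> nat_of_bin (step_distN bin L r a d) = step L r distn a d.
  move=> r_gt0; rewrite step_diff // => [|x y k]; last by rewrite /distn !subnDr.
  rewrite /step_distN sumNE; apply: eq_bigr => i _.
  rewrite mulNE binE sumNE; congr (_ * _); apply: eq_bigr => j _.
  by rewrite !mulNE !binE bin_of_natK.
by apply: (stepE) => a d; apply: (stepE) => {}a {}d; rewrite !lookupE distE.
Qed.

(** * Digraphs, pairs and reorderings *)

Local Open Scope ring_scope.

Lemma sum_total_sym (V : finType) (le : rel V) (g : V -> V -> rat) :
    total le -> antisymmetric le -> (forall u v, g u v = g v u) ->
  (\sum_(u : V) \sum_(v : V | (u != v) && le u v) g u v) *+ 2 =
  \sum_(u : V) \sum_(v : V | u != v) g u v.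
Proof.
move=> le_total le_anti gC; rewrite mulr2n.
rewrite [X in _ + X](exchange_big_dep predT) //= -big_split; apply: eq_bigr => u _ /=.
rewrite [RHS](bigID (le u)) /=; congr (_ + _).
apply: eq_big => [v|v _]; last exact: gC.
rewrite [v == u]eq_sym; have [//|uv] /= := eqVneq u v.
have := le_total u v; case: (boolP (le u v)) => [luv _|_ /= -> //].
by apply: contraNF uv => lvu; rewrite [u == v](introT eqP) //; apply: le_anti; rewrite luv lvu.
Qed.

(** Twice either sum is the sum over all ordered pairs of distinct values, which involves no
    order. *)
Lemma eq_sum_total_sym (V : finType) (le lt : rel V) (g : V -> V -> rat) :
    total le -> antisymmetric le -> (forall u v, lt u v -> lt v u = false) ->
    (forall u v, u != v -> lt u v || lt v u) ->
    (forall u v, g u v = g v u) ->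
  \sum_(u : V) \sum_(v : V | (u != v) && le u v) g u v =
  \sum_(u : V) \sum_(v : V | lt u v) g u v.
Proof.
move=> le_total le_anti lt_asym lt_total gC.
pose le' : rel V := fun u v => (u == v) || lt u v.
have le'_total : total le'.
  move=> u v; rewrite /le' [v == u]eq_sym.
  by have [//|/lt_total] := eqVneq u v.
have le'_anti : antisymmetric le'.
  move=> u v; rewrite /le' [v == u]eq_sym.
  by have [//|_ /= /andP[/lt_asym->]] := eqVneq u v.
apply: (@pmulrnI rat 2 isT) => /=.
rewrite (sum_total_sym le_total le_anti gC) -(sum_total_sym le'_total le'_anti gC).
congr (_ *+ 2); apply: eq_bigr => u _; apply: eq_bigl => v; rewrite /le'.
have [<-|//] := eqVneq u v.
by apply/esym/negP => h; have := lt_asym _ _ h; rewrite h.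
Qed.

Lemma steps_nth (T : eqType) (e : rel T) (x0 : T) s :
  steps e s = (\sum_(i < size s) ((i.+1 < size s) && e (nth x0 s i) (nth x0 s i.+1)))%N.
Proof.
case: s => [|x s]; first by rewrite big_ord0.
elim: s x => [|y s IHs] x; first by rewrite big_ord1.
rewrite big_ord_recl /=; congr (_ + _)%N; exact: IHs.
Qed.

(** Each consecutive pair [x], [y] of the word is counted only at [u = x], [v = y], and only if
    [P x y]. *)
Lemma sum_steps_pair (V : finType) (P : rel V) s :
  (\sum_(u : V) \sum_(v : V | P u v) steps (fun x y => (x == u) && (y == v)) s)%N =
  steps P s.
Proof.
case: s => [|x s] /=; first by rewrite big1 // => u _; rewrite big1.
elim: s x => [|y s IHs] x /=; first by rewrite big1 // => u _; rewrite big1.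
under eq_bigr => u _ do rewrite big_split.
rewrite big_split IHs; congr (_ + _)%N.
rewrite (bigD1 x) //= [X in (_ + X)%N]big1 => [|u ux]; last first.
  by rewrite big1 // => v _; rewrite eq_sym (negbTE ux).
rewrite addn0 big_mkcond (bigD1 y) //= !eqxx big1 => [|v vy].
  by rewrite addn0; case: (P x y).
by rewrite [y == v]eq_sym (negbTE vy) andbF; case: ifP.
Qed.

Section Decks.
Variables (n : nat) (V : finType).
Implicit Types (D : n.-tuple V).

Lemma ndigraphsE D u v :
  ndigraphs D u v = steps (fun x y => (x == u) && (y == v)) D.
Proof.
rewrite (steps_nth _ u) size_tuple /ndigraphs -sum1dep_card big_mkcond /=.
apply: eq_bigr => i _; case: existsP => [[j /and3P[/eqP ji iu jv]]|nj].
  by rewrite -ji ltn_ord -!(tnth_nth u) iu jv.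
case: (boolP (_ && _)) => // /and3P[lt_in /eqP iu /eqP jv].
by case: nj; exists (Ordinal lt_in); rewrite !(tnth_nth u) /= iu jv !eqxx.
Qed.

(** Sums over numeric ranges can be evaluated by computation, unlike the cardinal of a finite
    set. *)
Lemma npairsE D x0 u v : npairs D u v =
  (\sum_(0 <= i < n) \sum_(0 <= j < n)
     [&& i < j, nth x0 D i == u & nth x0 D j == v])%N.
Proof.
rewrite big_mkord /npairs -sum1dep_card big_mkcond /=.
rewrite -(pair_bigA _ (fun i j : 'I_n =>
   if [&& i < j, tnth D i == u & tnth D j == v]%N then 1 else 0)%N) /=.
apply: eq_bigr => i _; rewrite big_mkord; apply: eq_bigr => j _.
by rewrite !(tnth_nth x0); case: ifP.
Qed.

Lemma sum_Wstat (lt : rel V) D :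
  \sum_(u : V) \sum_(v : V | lt u v) Wstat D u v = (asc lt D)%:R - (des lt D)%:R.
Proof.
rewrite /asc /des -!sum_steps_pair [X in _ - X%:R](exchange_big_dep predT) //=.
rewrite !natr_sum -sumrB; apply: eq_bigr => u _.
rewrite !natr_sum -sumrB; apply: eq_bigr => v _.
by rewrite /Wstat !ndigraphsE.
Qed.

Lemma sum_reorderings D (F : seq V -> rat) :
  \sum_(D1 in reorderings D) F D1 = \sum_(s <- permutations D) F s.
Proof.
rewrite -big_enum -(big_map (fun D1 : n.-tuple V => tval D1) xpredT F) /=.
apply: perm_big; apply: uniq_perm; rewrite ?permutations_uniq //.
  by rewrite map_inj_uniq ?enum_uniq //; apply: val_inj.
move=> s; rewrite mem_permutations; apply/mapP/idP => [[D1]|sD].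
  by rewrite mem_enum inE => h ->.
have sz : size s == n by rewrite (perm_size sD) size_tuple.
by exists (Tuple sz); rewrite ?mem_enum ?inE.
Qed.

Lemma card_reorderings D : #|reorderings D| = size (permutations D).
Proof.
apply/eqP; rewrite -(eqr_nat rat) -sum1_card -sum1_size !natr_sum.
by rewrite (sum_reorderings D (fun=> 1)).
Qed.

End Decks.

(** * The bridge decks: reduction of [kappa1] to the total of |ascents - descents| *)

Lemma norm_subr_nat a d : `|a%:R - d%:R| = (distn a d)%:R :> rat.
Proof.
rewrite /distn; case: (leqP a d) => [ad|/ltnW ad].
  by rewrite distrC -natrB // ger0_norm // [(a - d)%N](_ : _ = 0)%N //; apply/eqP.
by rewrite -natrB // ger0_norm // [(d - a)%N](_ : _ = 0)%N ?addn0 //; apply/eqP.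
Qed.

Definition seat_lt : rel seat := fun u v => (ord_of_seat u < ord_of_seat v)%N.

Lemma seat_lt_asym u v : seat_lt u v -> seat_lt v u = false.
Proof. by case: u; case: v. Qed.

Lemma seat_lt_total u v : u != v -> seat_lt u v || seat_lt v u.
Proof. by case: u; case: v. Qed.

(** The left-nested form exposes the largest letter as the last block at every stage. *)
Lemma word_ordE : word_ord =
  ((nseq 13 North ++ nseq 13 East) ++ nseq 13 South) ++ nseq 13 West.
Proof. by []. Qed.

Lemma permutations_nseq (T : eqType) k (x : T) : permutations (nseq k x) = [:: nseq k x].
Proof.
apply/perm_small_eq => //; apply: uniq_perm; rewrite ?permutations_uniq // => s.
rewrite mem_permutations inE; apply/idP/eqP => [sk|-> //].
have /all_pred1P-> : all (pred1 x) s by rewrite (perm_all _ sk) all_pred1_nseq.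
by rewrite (perm_size sk) size_nseq.
Qed.

Lemma size_permutations_ord :
  size (permutations word_ord) = ('C(13 + 13, 13) * 'C(13 + 13 + 13, 13)
    * 'C(13 + 13 + 13 + 13, 13))%N.
Proof.
rewrite word_ordE; do 3![rewrite size_permutations_cat_nseq; last by []].
rewrite permutations_nseq !size_cat !size_nseq [size [:: _]]/= mul1n.
exact: erefl.
Qed.

Lemma sum_distn_ord :
  (\sum_(s <- permutations word_ord) distn (asc seat_lt s) (des seat_lt s))%N =
  nat_of_bin distn_total.
Proof.
rewrite word_ordE distn_totalE.
do 3![rewrite big_permutations_step //; last exact: seat_lt_asym].
by rewrite permutations_nseq big_seq1 !size_cat !size_nseq.
Qed.

Definition ord_total : N := N.mul
  (N.mul (nth N0 (pascal_row (13 + 13)) 13) (nth N0 (pascal_row (13 + 13 + 13)) 13))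
  (nth N0 (pascal_row (13 + 13 + 13 + 13)) 13).

Lemma ord_totalE : size (permutations word_ord) = nat_of_bin ord_total.
Proof.
rewrite size_permutations_ord -(pascal_rowE (13 + 13)) -(pascal_rowE (13 + 13 + 13)).
rewrite -(pascal_rowE (13 + 13 + 13 + 13)).
rewrite /ord_total; move: (nth _ _ _) (nth _ _ _) (nth _ _ _) => a b c.
by rewrite !nat_of_mul_bin.
Qed.

Lemma kappa1_seats (le : rel seat) (D' : 52.-tuple seat) (z : nat) :
    total le -> antisymmetric le -> perm_eq D' word_ord ->
    (forall u v, seat_lt u v -> npairs D' u v = (npairs D' v u + z)%N) ->
  kappa1 le D' = z%:R / 13%:R * ((nat_of_bin distn_total)%:R / (nat_of_bin ord_total)%:R).
Proof.
move: ord_totalE sum_distn_ord.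
(* The two huge numbers become variables, so that no tactic tries to evaluate them. *)
move: (nat_of_bin distn_total) (nat_of_bin ord_total) => S N sizeE sumE.
move=> le_total le_anti D'ord D'Z.
have cD' u : count_mem u D' = 13%N by rewrite (permP D'ord); case: u.
have pD' : perm_eq (permutations D') (permutations word_ord).
  apply: uniq_perm; rewrite ?permutations_uniq // => s.
  by rewrite !mem_permutations (permPr D'ord).
have c1E D : `|c1 le D D'| = 52%:R / (2 * N%:R) * (z%:R / (13%:R * 13%:R))
    * (distn (asc seat_lt D) (des seat_lt D))%:R.
  rewrite /c1 card_reorderings (perm_size pD') sizeE.
  rewrite (eq_sum_total_sym le_total le_anti seat_lt_asym seat_lt_total); last first.
    (* Exchanging [u] and [v] changes the sign of both W and Z. *)
    by move=> u v; rewrite !cD' -[Wstat D v u]opprB -[Zstat D' v u]opprB mulrNN.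
  under eq_bigr => u _ do under eq_bigr => v uv do
    rewrite /(Zstat D' u v) (D'Z _ _ uv) natrD addrAC subrr add0r !cD' -mulrA.
  under eq_bigr do rewrite -mulr_suml.
  rewrite -mulr_suml sum_Wstat -norm_subr_nat.
  have : 0 <= z%:R / (13%:R * 13%:R) :> rat by apply: divr_ge0; rewrite ?mulr_ge0 ?ler0n.
  have : 0 <= 52%:R / (2 * N%:R) :> rat by apply: divr_ge0; rewrite ?mulr_ge0 ?ler0n.
  move: (52%:R / _) (z%:R / _) (_ - _) => c q x c0 q0.
  by rewrite !normrM (ger0_norm c0) (ger0_norm q0) [`|x| * _]mulrC mulrA.
rewrite /kappa1; under eq_bigr => D _ do rewrite c1E.
rewrite (sum_reorderings D' (fun s => 52%:R / (2 * N%:R)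
  * (z%:R / (13%:R * 13%:R)) * (distn (asc seat_lt s) (des seat_lt s))%:R)).
rewrite -mulr_sumr (perm_big _ pD') -natr_sum sumE.
(* With the inverse of [N] as an atom, [field] needs no condition on [N]; the constants combine as
   52 / (4 * 13 * 13) = 1 / 13. *)
rewrite [(2 * _)^-1]invfM; move: (S%:R : rat) (N%:R^-1 : rat) (z%:R : rat) => s p q.
by field.
Qed.

Lemma npairs_ord u v : seat_lt u v -> npairs D_ord u v = (npairs D_ord v u + 169)%N.
Proof.
by case: u; case: v => // _; rewrite !(npairsE _ North) unlock; vm_compute.
Qed.

(** Pairs from two different blocks NESW cancel, and each of the 13 blocks contributes 1. *)
Lemma npairs_cyc u v : seat_lt u v -> npairs D_cyc u v = (npairs D_cyc v u + 13)%N.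
Proof.
by case: u; case: v => // _; rewrite !(npairsE _ North) unlock; vm_compute.
Qed.

(** Pairs between blocks cancel, as do those inside a palindrome NESWWSEN; only the final NESW
    contributes. *)
Lemma npairs_bf u v : seat_lt u v -> npairs D_bf u v = (npairs D_bf v u + 1)%N.
Proof.
by case: u; case: v => // _; rewrite !(npairsE _ North) unlock; vm_compute.
Qed.

(** * Large decimal literals in binary *)

Definition push_digit (k acc : N) : N := N.add k (N.mul 10 acc).

(** [Nat.tail_mul] is kept because the standard reading of digits uses it; the induction step of
    [num_uintE] then holds by conversion. *)
Lemma push_digitE k acc :
  nat_of_bin (push_digit k acc) = (nat_of_bin k + Nat.tail_mul 10 (nat_of_bin acc))%N.
Proof. by rewrite nat_of_add_bin nat_of_mul_bin PeanoNat.Nat.tail_mul_spec. Qed.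

Fixpoint uintN (d : Decimal.uint) (acc : N) : N :=
  match d with
  | Decimal.Nil => acc
  | Decimal.D0 d => uintN d (push_digit 0 acc)
  | Decimal.D1 d => uintN d (push_digit 1 acc)
  | Decimal.D2 d => uintN d (push_digit 2 acc)
  | Decimal.D3 d => uintN d (push_digit 3 acc)
  | Decimal.D4 d => uintN d (push_digit 4 acc)
  | Decimal.D5 d => uintN d (push_digit 5 acc)
  | Decimal.D6 d => uintN d (push_digit 6 acc)
  | Decimal.D7 d => uintN d (push_digit 7 acc)
  | Decimal.D8 d => uintN d (push_digit 8 acc)
  | Decimal.D9 d => uintN d (push_digit 9 acc)
  end.

Lemma num_uintE d : Nat.of_num_uint (Number.UIntDecimal d) = nat_of_bin (uintN d 0).
Proof.
rewrite /Nat.of_num_uint /Nat.of_uint -[0%N]/(nat_of_bin 0).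
elim: d (0%num) => [//|d IHd acc|d IHd acc|d IHd acc|d IHd acc|d IHd acc
  |d IHd acc|d IHd acc|d IHd acc|d IHd acc|d IHd acc].
all: by etransitivity; [|exact: IHd]; rewrite push_digitE.
Qed.

(** The numerical hypotheses are cross-multiplied identities and tests in [N], which can be checked
    without unary numbers. *)
Lemma ratios_of_total (T N A A' B B' : N) (k_ord k_cyc k_bf : rat) :
    k_ord = 169%:R / 13%:R * ((nat_of_bin T)%:R / (nat_of_bin N)%:R) ->
    k_cyc = 13%:R / 13%:R * ((nat_of_bin T)%:R / (nat_of_bin N)%:R) ->
    k_bf = 1%:R / 13%:R * ((nat_of_bin T)%:R / (nat_of_bin N)%:R) ->
    N.eqb N 0 = false -> N.eqb B 0 = false ->
    N.mul (N.mul 13 T) B = N.mul A N -> A = N.mul 13 A' -> B' = N.mul 13 B ->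
  [/\ k_ord = (nat_of_bin A)%:R / (nat_of_bin B)%:R,
      k_cyc = 1 / 13%:R * k_ord
      /\ 1 / 13%:R * k_ord = (nat_of_bin A')%:R / (nat_of_bin B)%:R
    & k_bf = 1 / 13%:R * k_cyc
      /\ 1 / 13%:R * k_cyc = (nat_of_bin A')%:R / (nat_of_bin B')%:R].
Proof.
move=> -> -> -> N0 B0 TB AE BE.
have nz x : N.eqb x 0 = false -> (nat_of_bin x)%:R != 0 :> rat.
  by apply: contraFneq => /eqP; rewrite pnatr_eq0 -[in N.eqb x _](nat_of_binK x) => /eqP->.
have /(congr1 (fun x => (nat_of_bin x)%:R : rat)) := TB.
rewrite BE AE !nat_of_mul_bin (_ : nat_of_bin 13 = 13%N) ?natrM //.
move: (nz _ N0) (nz _ B0); move: (nat_of_bin T)%:R (nat_of_bin N)%:R => t n.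
move: (nat_of_bin A')%:R (nat_of_bin B)%:R => a b n0 b0 tb.
(* After cancelling 13, the mean T / N itself is A' / B, and the three values are 13, 1 and 1/13
   times it. *)
have {}tb : t / n = a / b.
  apply/eqP; rewrite eqr_div //; apply/eqP.
  by apply: (@mulfI rat 13%:R) => //; rewrite !mulrA.
by rewrite tb; split; [|split|split]; field.
Qed.

Theorem mainTheorem2 (le : rel seat)
    (le_total : total le) (le_anti : antisymmetric le)
    (le_trans : transitive le) :
  [/\ kappa1 le D_ord =
        93574839271687495932003418573%N%:R
        / 3352796110343049552452340000%N%:R,
      kappa1 le D_cyc = 1 / 13%:R * kappa1 le D_ord
      /\ 1 / 13%:R * kappa1 le D_ord =
        7198064559360576610154109121%N%:R
        / 3352796110343049552452340000%N%:R
    & kappa1 le D_bf = 1 / 13%:R * kappa1 le D_cyc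
      /\ 1 / 13%:R * kappa1 le D_cyc =
        7198064559360576610154109121%N%:R
        / 43586349434459644181880420000%N%:R].
Proof.
have ord_perm : perm_eq D_ord word_ord by [].
have cyc_perm : perm_eq D_cyc word_ord by [].
have bf_perm : perm_eq D_bf word_ord by [].
(* The literals become binary numbers, which then instantiate [A], [A'], [B] and [B'] by
   unification. *)
rewrite !num_uintE.
apply: (@ratios_of_total distn_total ord_total).
- exact: kappa1_seats le_total le_anti ord_perm npairs_ord.
- exact: kappa1_seats le_total le_anti cyc_perm npairs_cyc.
- exact: kappa1_seats le_total le_anti bf_perm npairs_bf.
- by vm_compute.
- by vm_compute.
- by vm_compute.
- by vm_compute.
- by vm_compute.
Qed.
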